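(* Let $U$ be uniformly distributed on $[0,1]$, for real $n>0$ let $Z_n=\big(U^n+(1-U)^n\big)^{1/n}$, and let $Z_\infty=\max\{U,1-U\}$. Let $F_n(x)=\mathbb{P}\{Z_n\le x\}$ and $F_\infty(x)=\mathbb{P}\{Z_\infty\le x\}$ be their distribution functions. Then there is a constant $C$, independent of $n$, such that \[ \sup_{x\in \mathbb{R}}| F_{n}(x)-F_{\infty}(x)| \le \frac{C}{n}. \] *)

(* Defs.v *)
From HB Require Import structures.
From mathcomp Require Import all_boot all_order all_algebra.
From mathcomp Require Import all_classical all_reals all_analysis.
From mathcomp Require Import measurable_realfun.

Set Implicit Arguments.
Unset Strict Implicit.
Unset Printing Implicit Defensive.

Import Order.TTheory GRing.Theory Num.Theory.
Import numFieldNormedType.Exports.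

Local Open Scope classical_set_scope.
Local Open Scope ring_scope.

(* Equality of laws is required on measurable sets only: the values of a
   measure on non-measurable sets are junk. *)
Definition uniformly_distributed d (T : measurableType d) (R : realType)
    (P : probability T R) (a b : R) (ab : a < b) (U : {RV P >-> R}) : Prop :=
  forall A : set R, measurable A -> distribution P U A = uniform_prob ab A.
Arguments uniformly_distributed {d T R} P {a b} ab U.

(* `^ is not the usual power on negative bases, but a variable uniformly
   distributed on [0, 1] makes both bases nonnegative almost surely. *)
Definition Z_ d (T : measurableType d) (R : realType) (U : {mfun T >-> R})
    (n : R) : T -> R :=
  fun w => (U w `^ n + (1 - U w) `^ n) `^ n^-1.

Definition Z_infty d (T : measurableType d) (R : realType)
    (U : {mfun T >-> R}) : T -> R :=
  fun w => Num.max (U w) (1 - U w).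

Section measurability.
Context d (T : measurableType d) (R : realType) (U : {mfun T >-> R}).

Let mU1 : measurable_fun setT (fun w => 1 - U w).
Proof. exact: measurable_funB. Qed.

Lemma measurable_Z_ (n : R) : measurable_fun setT (Z_ U n).
Proof.
apply: (measurableT_comp (measurable_powR n^-1)).
apply: measurable_funD; first exact: (measurableT_comp (measurable_powR n)).
exact: (measurableT_comp (measurable_powR n)).
Qed.

Lemma measurable_Z_infty : measurable_fun setT (Z_infty U).
Proof. exact: measurable_maxr. Qed.

HB.instance Definition _ (n : R) :=
  isMeasurableFun.Build _ _ T R (Z_ U n) (measurable_Z_ n).

HB.instance Definition _ :=
  isMeasurableFun.Build _ _ T R (Z_infty U) measurable_Z_infty.

End measurability.

(* Main.v *)
Require Import Defs.
From HB Require Import structures.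
From mathcomp Require Import all_boot all_order all_algebra.
From mathcomp Require Import all_classical all_reals all_analysis.
From mathcomp Require Import measurable_realfun lra.

(** Write [M = max (U, 1 - U)].  Both terms of [U^n + (1 - U)^n] lie between
    [0] and [M^n] and one of them equals [M^n], so almost surely
    [M <= Z_n <= 2^(1/n) M].  Young's inequality gives [2^(1/n) <= 1 + 1/n] for
    [n > 1], and [M <= 1], hence [M <= Z_n <= M + 1/n]: the two variables are
    uniformly within [1/n] of each other ([Z_sandwich]).

    Whenever [X <= Y <= X + e] almost surely, the events [X <= x] and [Y <= x]
    differ, up to a null set, only when [x - e < X <= x] ([cdf_dist_le]).  For
    [X = M] this forces [U] into one of two intervals of length [e], which has
    probability at most [2 e] because the uniform law on [0, 1] is dominated by
    Lebesgue measure ([Z_infty_window]).  With [e = 1/n] this is the bound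
    [2/n]; for [n <= 1] the same bound is weaker than the trivial bound [1]. *)

Set Implicit Arguments.
Unset Strict Implicit.
Unset Printing Implicit Defensive.

Import Order.TTheory GRing.Theory Num.Theory.
Import numFieldNormedType.Exports.

Local Open Scope classical_set_scope.
Local Open Scope ring_scope.

Section powers.
Variable R : realType.
Implicit Types a b n : R.

(** Young's inequality for the product [2^(1/n) * 1] with exponent [n]. *)
Lemma powR2V_le n : 1 < n -> 2 `^ n^-1 <= 1 + n^-1.
Proof.
move=> n1; have n0 : 0 < n by lra.
have nV1 : n^-1 < 1 by rewrite invf_lt1.
have /= := @conjugate_powR _ (2 `^ n^-1) 1 n (1 - n^-1)^-1.
rewrite powR_ge0 ler01 n0 invr_gt0 subr_gt0 nV1 invrK subrKC.
move=> /(_ isT isT isT isT erefl).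
rewrite -powRrM mulVf ?gt_eqF// powRr1// powR1 mulr1 mul1r => /le_trans; apply.
lra.
Qed.

Lemma max_le_pnorm a b n : 0 <= a -> 0 <= b -> 0 < n ->
  Num.max a b <= (a `^ n + b `^ n) `^ n^-1.
Proof.
move=> a0 b0 n0.
have powRKV c : 0 <= c -> c = (c `^ n) `^ n^-1.
  by move=> c0; rewrite -powRrM mulfV ?gt_eqF// powRr1.
rewrite ge_max {1}(powRKV a)// {2}(powRKV b)//.
by rewrite !ge0_ler_powR ?nnegrE ?addr_ge0 ?powR_ge0 ?invr_ge0 ?(ltW n0)//
  ?lerDl ?lerDr ?powR_ge0.
Qed.

Lemma pnorm_le_max a b n : 0 <= a -> 0 <= b -> 0 < n ->
  (a `^ n + b `^ n) `^ n^-1 <= 2 `^ n^-1 * Num.max a b.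
Proof.
move=> a0 b0 n0; set m := Num.max a b.
have m0 : 0 <= m by rewrite le_max a0.
have -> : 2 `^ n^-1 * m = (2 * m `^ n) `^ n^-1.
  by rewrite powRM ?powR_ge0// -powRrM mulfV ?gt_eqF// powRr1.
apply: ge0_ler_powR; rewrite ?nnegrE ?addr_ge0 ?mulr_ge0 ?powR_ge0//.
  by rewrite invr_ge0 ltW.
by rewrite mulr_natl mulr2n lerD// ge0_ler_powR ?nnegrE ?(ltW n0)//
  le_max lexx ?orbT.
Qed.

End powers.

Section measure_comparison.

Lemma ae_le_measure d (T : measurableType d) (R : realType)
    (mu : {measure set T -> \bar R}) (A B : set T) :
  measurable A -> measurable B -> (\forall w \ae mu, A w -> B w) ->
  (mu A <= mu B)%E.
Proof.
move=> mA mB [N [mN muN0 subN]].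
have -> : (mu B = mu B + mu N)%E by rewrite muN0 adde0.
apply: (le_trans _ (measureU2 _ mB mN)).
apply: le_measure; rewrite ?inE//; first exact: measurableU.
move=> w Aw; have [Bw|nBw] := pselect (B w); [by left|right].
by apply: subN => /= /(_ Aw).
Qed.

Lemma lee_dist_le (R : realDomainType) (x y c : \bar R) :
  y \is a fin_num -> (x <= y)%E -> (y <= x + c)%E -> (0 <= c)%E ->
  (`|x - y| <= c)%E.
Proof.
case: x y c => [x| |] [y| |] [c| |] //= _; rewrite !lee_fin ?leey//.
by rewrite ler_norml; lra.
Qed.

Lemma cdf_dist_le1 d (T : measurableType d) (R : realType)
    (P : probability T R) (X Y : {RV P >-> R}) (x : R) :
  (`|cdf Y x - cdf X x| <= 1)%E.
Proof.
have cdf_fin (Z : {RV P >-> R}) : cdf Z x \is a fin_num.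
  by rewrite /cdf; exact: fin_num_measure.
move: (cdf_ge0 X x) (cdf_le1 X x) (cdf_ge0 Y x) (cdf_le1 Y x).
move: (cdf_fin X) (cdf_fin Y).
case: (cdf X x) (cdf Y x) => [a| |] [b| |] //.
by rewrite -EFinB abse_EFin !lee_fin ler_norml; lra.
Qed.

(** Almost surely [X <= x < Y] forces [x - e < X <= x], while [Y <= x < X]
    cannot happen. *)
Lemma cdf_dist_le d (T : measurableType d) (R : realType)
    (P : probability T R) (X Y : {RV P >-> R}) (e x : R) :
  (\forall w \ae P, X w <= Y w <= X w + e) ->
  (`|cdf Y x - cdf X x| <= distribution P X `](x - e)%R, x])%E.
Proof.
move=> XY; have mX (i : interval R) : measurable (X @^-1` [set` i]).
  exact: measurable_funPTI.
have mY (i : interval R) : measurable (Y @^-1` [set` i]).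
  exact: measurable_funPTI.
apply: lee_dist_le => //; rewrite /cdf /distribution /pushforward.
- exact: fin_num_measure.
- apply: ae_le_measure => //; apply: filterS XY => w /andP[XYw _] /=.
  by rewrite !in_itv/=; exact: le_trans.
- apply: (le_trans _ (measureU2 P (mY _) (mX _))).
  apply: ae_le_measure => //; first exact: measurableU.
  apply: filterS XY => w /andP[_ YXw] /=; rewrite !in_itv/= => Xx.
  by have [Yx|xY] := leP (Y w) x; [left|right]; rewrite // Xx andbT; lra.
Qed.

End measure_comparison.

Section uniform.
Context (R : realType) (d : measure_display) (T : measurableType d).
Context (P : probability T R) (U : {RV P >-> R}).

(** The density of the uniform law on [0, 1] is at most [1]. *)
Lemma uniform_prob01_le_lebesgue (A : set R) : measurable A ->
  (uniform_prob (@ltr01 R) A <= lebesgue_measure A)%E.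
Proof.
move=> mA; rewrite /uniform_prob -[leRHS]mul1e.
rewrite -(@integral_cst _ _ _ lebesgue_measure)//.
apply: ge0_le_integral => //=.
- by move=> x _; rewrite lee_fin uniform_pdf_ge0.
- by apply/measurable_EFinP/measurable_funTS; exact: measurable_uniform_pdf.
- by move=> x _; rewrite lee_fin /uniform_pdf subr0 invr1; case: ifP.
Qed.

Hypothesis hU : uniformly_distributed P (@ltr01 R) U.

Lemma uniform_ae_itv01 : \forall w \ae P, 0 <= U w <= 1.
Proof.
exists (U @^-1` ~` `[0, 1]); split.
- by apply: measurable_funPTI; exact: measurableC.
- have := hU (measurableC (measurable_itv `[0, 1])).
  rewrite /distribution /pushforward => ->.
  by rewrite /uniform_prob integral_uniform_pdf setICl integral_set0.
- by move=> w /=; rewrite in_itv.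
Qed.

Lemma uniform_itv_le (i : interval R) (e : R) : 0 <= e ->
  (lebesgue_measure [set` i] <= e%:E)%E -> (P (U @^-1` [set` i]) <= e%:E)%E.
Proof.
move=> e0; apply: le_trans; rewrite -[leLHS]/(distribution P U [set` i]) hU//.
exact: uniform_prob01_le_lebesgue.
Qed.

(** The maximum is one of [U], [1 - U], and each of these lies in a given
    interval of length [e] with probability at most [e]. *)
Lemma Z_infty_window (e x : R) : 0 <= e ->
  (distribution P (Z_infty U : {RV P >-> R}) `](x - e)%R, x] <= (2 * e)%:E)%E.
Proof.
move=> e0.
have mU (i : interval R) : measurable (U @^-1` [set` i]).
  exact: measurable_funPTI.
(* [1 - U] is in (x - e, x] exactly when [U] is in [1 - x, 1 - x + e). *)
apply: (@le_trans _ _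
  (P (U @^-1` `](x - e)%R, x] `|` U @^-1` `[1 - x, 1 - x + e[))).
  rewrite /distribution /pushforward; apply: le_measure; rewrite ?inE; last first.
  - move=> w; rewrite /= /Z_infty !in_itv/= maxEle.
    by case: ifP => _ /andP[? ?]; [right|left]; lra.
  - exact: measurableU.
  - exact: measurable_funPTI.
rewrite mulr_natl mulr2n EFinD; apply: (le_trans (measureU2 P (mU _) (mU _))).
by apply: leeD; apply: uniform_itv_le => //; rewrite lebesgue_measure_itv/=;
  case: ifP => _; rewrite lee_fin//; lra.
Qed.

Lemma Z_sandwich (n : R) : 1 < n ->
  \forall w \ae P, Z_infty U w <= Z_ U n w <= Z_infty U w + n^-1.
Proof.
move=> n1; have n0 : 0 < n by lra.
apply: filterS uniform_ae_itv01 => w /andP[U0 U1].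
have V0 : 0 <= 1 - U w by lra.
rewrite /Z_infty /Z_ max_le_pnorm//=; apply: (le_trans (pnorm_le_max _ _ _)) => //.
set M := Num.max _ _.
have M0 : 0 <= M by rewrite le_max U0.
have M1 : M <= 1 by rewrite ge_max; lra.
apply: (le_trans (ler_wpM2r M0 (powR2V_le n1))).
by rewrite mulrDl mul1r lerD2l ler_piMr// invr_ge0 ltW.
Qed.

End uniform.

Theorem corollary2 (R : realType) (d : measure_display)
    (T : measurableType d) (P : probability T R) (U : {RV P >-> R})
    (hU : uniformly_distributed P (@ltr01 R) U) :
  exists C : R, forall n : R, 0 < n ->
    (ereal_sup
      [set `|cdf (Z_ U n : {RV P >-> R}) x
             - cdf (Z_infty U : {RV P >-> R}) x| | x in [set: R]]
     <= (C / n)%:E)%E.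
Proof.
exists 2 => n n0; apply: ub_ereal_sup => _ [x _ <-].
have [n1|n1] := leP n 1.
  apply: (le_trans (cdf_dist_le1 _ _ _)).
  by rewrite lee_fin ler_pdivlMr// mul1r; lra.
apply: (le_trans (cdf_dist_le _ (Z_sandwich hU n1))).
by apply: Z_infty_window => //; rewrite invr_ge0 ltW.
Qed.
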